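(* Let $\mathcal H$ be a real separable Hilbert space, let $T:\mathcal H\to\mathcal H$ be $\alpha$-averaged for some $\alpha\in(0,1]$ with $\operatorname{fix}T\neq\emptyset$, and let $R=\mathrm{id}-T$. Consider the iterates $(x_k)_{k\in\mathbb N}$ generated by the SuperMann scheme (described in the context) with either $c_0>0$ or $c_1>0$, and with $(d_k)_{k\in\mathbb N}$ being superlinear directions, i.e. $$\lim_{k\to\infty}\frac{\|R(x_k+d_k)\|}{\|Rx_k\|}=0 .$$ Then: (i) eventually, the stepsize $\tau_k=1$ is always accepted and safeguard updates $K_2$ are deactivated (i.e., the scheme reduces to the local method $x_{k+1}=x_k+d_k$ for all $k$ large enough); (ii) $(Rx_k)_{k\in\mathbb N}$ converges $Q$-superlinearly (to $0$); (iii) if there exists $D\ge0$ such that $\|d_k\|\le D\|Rx_k\|$ for all $k\in\mathbb N$, then $(x_k)_{k\in\mathbb N}$ converges $R$-superlinearly; (iv) if $c_0>0$, then the complement $\mathbb N\setminus K_0$ is finite.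
   Context: An operator $T$ is nonexpansive if $\|Tx-Ty\|\le\|x-y\|$ for all $x,y\in\mathcal H$; it is $\alpha$-averaged, $\alpha\in(0,1)$, if $T=(1-\alpha)\mathrm{id}+\alpha S$ for some nonexpansive $S:\mathcal H\to\mathcal H$; $1$-averaged means nonexpansive. $\operatorname{fix}T=\{z: Tz=z\}$. $Q$-superlinear convergence of $(Rx_k)$ to $0$: $\|Rx_{k+1}\|/\|Rx_k\|\to0$. $R$-superlinear convergence of $(x_k)$ to $x_\star$: $\|x_k-x_\star\|\le\Delta_k$ for some positive sequence $\Delta_k\to0$ with $\Delta_{k+1}/\Delta_k\to0$. SuperMann scheme. Parameters: $x_0\in\mathcal H$, $c_0,c_1,q\in[0,1)$, $\beta,\sigma\in(0,1)$, $\lambda\in(0,1/\alpha)$. Initialize $\eta_0=r_{\rm safe}=\|Rx_0\|$, $k=0$. Step 1. If $Rx_k=0$, stop. Step 2. Choose an update direction $d_k\in\mathcal H$. Step 3 (blind update, $k\in K_0$). If $\|Rx_k\|\le c_0\eta_k$, set $\eta_{k+1}=\|Rx_k\|$, $x_{k+1}=w_k:=x_k+d_k$ (the full step, $\tau_k=1$), and go to step 6. Step 4. Otherwise set $\eta_{k+1}=\eta_k$ and $\tau_k=1$. Step 5. Let $w_k=x_k+\tau_kd_k$. (a) (educated update, $k\in K_1$) If $\|Rx_k\|\le r_{\rm safe}$ and $\|Rw_k\|\le c_1\|Rx_k\|$, set $x_{k+1}=w_k$, update $r_{\rm safe}=\|Rw_k\|+q^k$, and go to step 6. (b) (safeguard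 update, $k\in K_2$) Else, if $\rho_k:=\|Rw_k\|^2-2\alpha\langle Rw_k,w_k-x_k\rangle\ge\sigma\|Rw_k\|\|Rx_k\|$, set $x_{k+1}=x_k-\lambda\frac{\rho_k}{\|Rw_k\|^2}Rw_k$ and go to step 6; otherwise replace $\tau_k\gets\beta\tau_k$ and repeat step 5. Step 6. Set $k\gets k+1$ and go to step 1. $K_0,K_1,K_2$ are the sets of indices of blind, educated and safeguard iterations. Standing assumption: no solution is found in finitely many steps, i.e. $Rx_k\ne0$ for all $k$ and $Rw_k\neq0$ for all candidate points $w_k$. *)

(* Defs.v *)
From HB Require Import structures.
From mathcomp Require Import all_boot all_order all_algebra.
From mathcomp Require Import all_classical all_reals all_analysis.

Set Implicit Arguments.
Unset Strict Implicit.
Unset Printing Implicit Defensive.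

Import Order.TTheory GRing.Theory Num.Theory.
Import numFieldNormedType.Exports.

Local Open Scope classical_set_scope.
Local Open Scope ring_scope.

(* A real Hilbert space is a complete normed module H over R : realType with a
   positive definite symmetric bilinear form ip : {dot H for idfun} that
   induces its norm. *)
Definition induces_norm (R : realType) (H : completeNormedModType R)
    (ip : {dot H for idfun}) : Prop :=
  forall x : H, `|x| ^+ 2 = ip x x.

Definition separable (T : topologicalType) : Prop :=
  exists2 D : set T, countable D & dense D.

Definition nonexpansive (R : realType) (H : normedModType R) (T : H -> H)
    : Prop :=
  forall x y : H, `|T x - T y| <= `|x - y|.

Definition averaged (R : realType) (H : normedModType R) (alpha : R)
    (T : H -> H) : Prop :=
  if alpha == 1 then nonexpansive T
  else exists2 S : H -> H, nonexpansive S &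
         forall x : H, T x = (1 - alpha) *: x + alpha *: S x.

Definition fix_points (H : Type) (T : H -> H) : set H := [set z | T z = z].

Definition residual (R : realType) (H : normedModType R) (T : H -> H) (x : H)
    : H :=
  x - T x.

Record sm_parameters (R : realType) := SuperMannParameters {
  sm_c0 : R; sm_c1 : R; sm_q : R; sm_beta : R; sm_sigma : R; sm_lambda : R }.

Definition admissible (R : realType) (alpha : R) (p : sm_parameters R) : Prop :=
  [/\ 0 <= sm_c0 p < 1, 0 <= sm_c1 p < 1 & 0 <= sm_q p < 1] /\
  [/\ 0 < sm_beta p < 1, 0 < sm_sigma p < 1 & 0 < sm_lambda p < 1 / alpha].

(* The data carried from one iteration to the next: x_k, eta_k and the value
   of r_safe at the beginning of iteration k. *)
Record state (R : realType) (H : normedModType R) := State {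
  iterate : H; eta : R; r_safe : R }.

Variant update := Blind | Educated | Safeguard.

(* The point w_k of the i-th pass through the line search, tau_k = beta ^ i. *)
Definition candidate (R : realType) (H : normedModType R) (p : sm_parameters R)
    (x d : H) (i : nat) : H :=
  x + sm_beta p ^+ i *: d.

Definition rho (R : realType) (H : completeNormedModType R)
    (ip : {dot H for idfun}) (alpha : R) (T : H -> H) (x w : H) : R :=
  `|residual T w| ^+ 2 - 2 * alpha * ip (residual T w) (w - x).

Definition educated_test (R : realType) (H : completeNormedModType R)
    (p : sm_parameters R) (T : H -> H) (s : state H) (w : H) : Prop :=
  `|residual T (iterate s)| <= r_safe s /\
  `|residual T w| <= sm_c1 p * `|residual T (iterate s)|.

Definition safeguard_test (R : realType) (H : completeNormedModType R)
    (ip : {dot H for idfun}) (alpha : R) (p : sm_parameters R) (T : H -> H)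
    (s : state H) (w : H) : Prop :=
  sm_sigma p * `|residual T w| * `|residual T (iterate s)|
    <= rho ip alpha T (iterate s) w.

Definition rejected (R : realType) (H : completeNormedModType R)
    (ip : {dot H for idfun}) (alpha : R) (p : sm_parameters R) (T : H -> H)
    (s : state H) (w : H) : Prop :=
  ~ educated_test p T s w /\ ~ safeguard_test ip alpha p T s w.

(* [step ip alpha p T k s d u j s'] : iteration k, started in state s with
   direction d, performs an update of kind u with accepted stepsize
   beta ^ j (that is, after j reductions of the stepsize) and ends in s'. *)
Inductive step (R : realType) (H : completeNormedModType R)
    (ip : {dot H for idfun}) (alpha : R) (p : sm_parameters R) (T : H -> H)
    (k : nat) (s : state H) (d : H) : update -> nat -> state H -> Prop :=
| BlindStep :
    `|residual T (iterate s)| <= sm_c0 p * eta s ->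
    step ip alpha p T k s d Blind 0
      (State (iterate s + d) `|residual T (iterate s)| (r_safe s))
| EducatedStep (j : nat) (w := candidate p (iterate s) d j) :
    ~ `|residual T (iterate s)| <= sm_c0 p * eta s ->
    (forall i : nat, (i < j)%N ->
       rejected ip alpha p T s (candidate p (iterate s) d i)) ->
    educated_test p T s w ->
    step ip alpha p T k s d Educated j
      (State w (eta s) (`|residual T w| + sm_q p ^+ k))
| SafeguardStep (j : nat) (w := candidate p (iterate s) d j) :
    ~ `|residual T (iterate s)| <= sm_c0 p * eta s ->
    (forall i : nat, (i < j)%N ->
       rejected ip alpha p T s (candidate p (iterate s) d i)) ->
    ~ educated_test p T s w ->
    safeguard_test ip alpha p T s w ->
    step ip alpha p T k s d Safeguard j
      (State
         (iterate s - (sm_lambda p * (rho ip alpha T (iterate s) w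
                                        / `|residual T w| ^+ 2))
                        *: residual T w)
         (eta s) (r_safe s)).

(* An infinite execution of the scheme from x0 with directions d_k: the states,
   the kinds of the updates, and the numbers of stepsize reductions. *)
Record supermann (R : realType) (H : completeNormedModType R)
    (ip : {dot H for idfun}) (alpha : R) (p : sm_parameters R) (T : H -> H)
    (x0 : H) (d : nat -> H) (s : nat -> state H) (u : nat -> update)
    (j : nat -> nat) : Prop := Supermann {
  supermann_init : s 0%N = State x0 `|residual T x0| `|residual T x0|;
  supermann_step : forall k : nat,
    step ip alpha p T k (s k) (d k) (u k) (j k) (s k.+1) }.

Definition stepsize (R : realType) (p : sm_parameters R) (j : nat -> nat)
    (k : nat) : R :=
  sm_beta p ^+ j k.

Definition indices_of (u : nat -> update) (v : update) : set nat :=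
  [set k | u k = v].

(* The candidates actually visited at iteration k are those with i <= j k. *)
Definition no_finite_termination (R : realType) (H : completeNormedModType R)
    (p : sm_parameters R) (T : H -> H) (d : nat -> H) (s : nat -> state H)
    (j : nat -> nat) : Prop :=
  (forall k : nat, residual T (iterate (s k)) != 0) /\
  (forall k i : nat, (i <= j k)%N ->
     residual T (candidate p (iterate (s k)) (d k) i) != 0).

Definition superlinear_directions (R : realType) (H : normedModType R)
    (T : H -> H) (x d : nat -> H) : Prop :=
  (fun k => `|residual T (x k + d k)| / `|residual T (x k)|) @ \oo --> (0 : R).

Definition q_superlinear_to0 (R : realType) (H : normedModType R)
    (y : nat -> H) : Prop :=
  (fun k => `|y k.+1| / `|y k|) @ \oo --> (0 : R).

Definition r_superlinear_to (R : realType) (H : normedModType R)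
    (x : nat -> H) (xstar : H) : Prop :=
  exists Delta : nat -> R,
    [/\ forall k, 0 < Delta k,
        Delta @ \oo --> (0 : R),
        (fun k => Delta k.+1 / Delta k) @ \oo --> (0 : R) &
        forall k, `|x k - xstar| <= Delta k].

(* Main.v *)
Require Import Defs.
From mathcomp Require Import all_boot all_order all_algebra.
From mathcomp Require Import all_classical all_reals all_analysis.
From mathcomp Require Import ring lra.
Import Order.TTheory GRing.Theory Num.Theory.
Import numFieldNormedType.Exports.
Local Open Scope classical_set_scope.
Local Open Scope ring_scope.

(** Write [res y] for the norm of [residual T y], and call a step
    [x k.+1 = x k + d k] full. By superlinearity of the directions, a full step
    taken late enough contracts the residual by any prescribed factor. The claim
    reduces to showing that from some index on only full steps are taken: the
    residual ratios of the scheme then coincide with those in the hypothesis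
    on [d].

    Each of the two fast updates is self-perpetuating once the contraction is
    available. A blind update stores [res (x k)] in [eta]; if the full step
    contracts by [c0], the next iterate passes the blind test again
    ([eventually_blind]). When [c0 = 0], blind updates never occur; an educated
    update makes [r_safe] at least the new residual, and if the full step
    contracts by [c1], the next iterate passes the educated test at stepsize 1
    again ([eventually_educated]).

    It remains to trigger one such late update. Its threshold, [c0 * eta] or
    [r_safe], is positive and stays fixed as long as the update in question does
    not happen, so a late iterate with a small residual suffices. A tail without
    blind updates always contains one ([nonblind_tail_small]), for one of two
    reasons. If the tail has only safeguard updates, each of them decreases the
    squared distance to a fixed point by at least a fixed multiple of the
    squared residual ([safeguard_fejer], [safeguard_tail_small]). If educated
    updates recur forever, a residual bounded away from 0 would force [r_safe]
    to drop by a fixed amount infinitely often, although it is positive and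
    eventually nonincreasing ([educated_infinitely_often_small]).

    When [|d k| <= D * res (x k)], the tail of the increments is dominated by a
    geometric series with first term of order [res (x k)], so [x] is a Cauchy
    sequence whose distance to its limit is eventually at most a multiple of
    [res (x k)] ([r_superlinear_of_increments]). *)

(** * Real sequences and superlinear decay *)

Section Sequences.
Set Implicit Arguments. Unset Strict Implicit.
Variable R : realType.
Implicit Types a r : nat -> R.

(** The sequence is eventually nonincreasing and bounded below, hence convergent.
    Its decrements therefore tend to 0. *)
Lemma decrement_lt a N (delta : R) :
  0 < delta -> (forall k, (N <= k)%N -> 0 <= a k) ->
  (forall k, (N <= k)%N -> a k.+1 <= a k) ->
  \forall k \near \oo, a k - a k.+1 < delta.
Proof.
move=> delta0 a0 aS.
pose b := [sequence a (n + N)%N]_n.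
have cb : cvgn b.
  apply: nonincreasing_is_cvgn.
    by apply/nonincreasing_seqP => n; apply: aS; rewrite leq_addl.
  by exists 0 => _ [n _ <-]; apply: a0; rewrite leq_addl.
have ca : a @ \oo --> limn b by rewrite -(cvg_shiftn N).
have caS : (fun k => a k.+1) @ \oo --> limn b by rewrite (cvg_shiftS a).
by apply: cvgr_lt delta delta0; rewrite -(subrr (limn b)); exact: cvgB.
Qed.

Lemma ratio_cvg0_le a r (c : R) :
  (forall k, 0 < r k) -> (fun k => a k / r k) @ \oo --> (0 : R) -> 0 < c ->
  exists N, forall k, (N <= k)%N -> a k <= c * r k.
Proof.
move=> r0 ratio0 c0.
have [N _ ltN] := @cvgr_lt _ _ _ _ _ _ ratio0 _ c0.
exists N => k /ltN /= ltc.
by rewrite -ler_pdivrMr // ltW.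
Qed.

(** Once the ratio is below 1/2 the decrement of [r] dominates [r / 2]. *)
Lemma ratio_cvg0_cvg0 r :
  (forall k, 0 < r k) -> (fun k => r k.+1 / r k) @ \oo --> (0 : R) ->
  r @ \oo --> (0 : R).
Proof.
move=> r0 ratio0.
have [|N rN] := ratio_cvg0_le r0 ratio0 (c := 2^-1); first by lra.
apply/cvgr0Pnorm_lt => e e0.
have e2 : 0 < e / 2 by lra.
have [||M _ decM] := decrement_lt (a := r) (N := N) e2.
- by move=> k _; exact: ltW.
- by move=> k /rN; have := r0 k; lra.
exists (maxn N M) => // k /=; rewrite geq_max => /andP[Nk Mk].
rewrite gtr0_norm //; have := decM _ Mk; have := rN _ Nk; rewrite /=; lra.
Qed.

(** The increments of [x] are eventually bounded by [D * r k] with [r] at least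
    halved at each step, so the tail of [x] stays within the geometric bound
    [2 * D * r k]; this gives both the limit and the rate. *)
Lemma r_superlinear_of_increments (H : completeNormedModType R)
    (x : nat -> H) r (D : R) N0 :
  (forall k, 0 < r k) -> (fun k => r k.+1 / r k) @ \oo --> (0 : R) ->
  0 <= D -> (forall k, (N0 <= k)%N -> `|x k.+1 - x k| <= D * r k) ->
  exists xstar : H, r_superlinear_to x xstar.
Proof.
move=> r0 ratio0 D0 xN0.
have [|N1 rN1] := ratio_cvg0_le r0 ratio0 (c := 2^-1); first by lra.
have r_cvg := ratio_cvg0_cvg0 r0 ratio0.
pose N := maxn N0 N1.
have tail m : forall k, (N <= k)%N -> `|x (k + m)%N - x k| <= 2 * D * r k.
  elim: m => [|m IHm] k Nk.
    by rewrite addn0 subrr normr0 !mulr_ge0 // ltW.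
  have := Nk; rewrite geq_max => /andP[N0k N1k].
  have Dr : D * r k.+1 <= D * (2^-1 * r k) by rewrite ler_wpM2l // rN1.
  have -> : x (k + m.+1)%N - x k
            = (x (k.+1 + m)%N - x k.+1) + (x k.+1 - x k).
    by rewrite addnS addSn addrA subrK.
  apply: le_trans (ler_normD _ _) _.
  by have := IHm _ (leqW Nk); have := xN0 _ N0k; lra.
have small e : 0 < e -> exists2 k, (N <= k)%N & 2 * D * r k < e.
  move=> e0.
  have c0 : (fun k => 2 * D * r k) @ \oo --> (0 : R).
    by rewrite -(mulr0 (2 * D)); apply: cvgMr.
  have [M _ ltM] := @cvgr_lt _ _ _ _ _ _ c0 _ e0.
  exists (maxn N M); first exact: leq_maxl.
  by apply: ltM; exact: leq_maxr.
have x_cvg : cvgn x.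
  apply/cauchy_cvgP; apply: cauchy_exP => e /small[k Nk rke].
  exists (x k); exists k => // n /= kn.
  rewrite -ball_normE /= distrC; apply: le_lt_trans rke.
  by have := tail (n - k)%N _ Nk; rewrite subnKC.
have lim_le k : (N <= k)%N -> `|x k - limn x| <= 2 * D * r k.
  move=> Nk; apply/ler_addgt0Pr => e e0.
  have [M _ ltM] := @cvgr_dist_lt _ _ _ _ _ _ _ x_cvg _ e0.
  have /= := ltM (k + M)%N (leq_addl _ _).
  have := tail M _ Nk; rewrite distrC => le1 lt2.
  have -> : x k - limn x = (x k - x (k + M)%N) - (limn x - x (k + M)%N).
    by rewrite opprB addrA subrK.
  apply: le_trans (ler_normB _ _) _; lra.
(* The +1 keeps Delta positive when D = 0; before N the distance is added. *)
pose Delta k := (2 * D + 1) * r k + (if (k < N)%N then `|x k - limn x| else 0).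
have DeltaN k : (N <= k)%N -> Delta k = (2 * D + 1) * r k.
  by rewrite /Delta leqNgt => /negbTE ->; rewrite addr0.
have D1 : 0 < 2 * D + 1 by lra.
exists (limn x); exists Delta; split.
- move=> k; rewrite /Delta ltr_pwDl ?mulr_gt0 //.
  by case: ifP.
- apply: cvg_trans (_ : (fun k => (2 * D + 1) * r k) @ \oo --> (0 : R)).
    by apply: near_eq_cvg; exists N => // k /= Nk; rewrite DeltaN.
  by rewrite -(mulr0 (2 * D + 1)); apply: cvgMr.
- apply: cvg_trans ratio0.
  apply: near_eq_cvg; exists N => // k /= Nk.
  rewrite !DeltaN ?(leqW Nk) // invfM mulrACA divff ?mul1r //; exact: lt0r_neq0.
- move=> k; have [kN|Nk] := ltnP k N.
    by rewrite /Delta kN lerDr mulr_ge0 // ltW.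
  by rewrite DeltaN // (le_trans (lim_le _ Nk)) // ler_wpM2r ?ltW //; lra.
Qed.

End Sequences.

(** * Geometry of the safeguard update *)

Section Geometry.
Set Implicit Arguments. Unset Strict Implicit.
Variables (R : realType) (H : completeNormedModType R).
Variables (ip : {dot H for idfun}) (ip_norm : induces_norm ip).
Variables (T : H -> H) (alpha : R).
Hypotheses (alpha0 : 0 < alpha) (T_averaged : averaged alpha T).

Lemma sqr_normB_scale (a b : H) (c : R) :
  `|a - c *: b| ^+ 2 = `|a| ^+ 2 - 2 * c * ip b a + c ^+ 2 * `|b| ^+ 2.
Proof.
have ipC : ip a b = ip b a by rewrite (hermC ip a b) /= expr0 mul1r.
rewrite !ip_norm linearBl !linearBr /= !(linearZl_LR ip) !(linearZr_LR ip) /= ipC.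
ring.
Qed.

Lemma averaged_residual : exists2 S : H -> H, nonexpansive S &
  forall x, residual T x = alpha *: (x - S x).
Proof.
move: T_averaged; rewrite /averaged /residual; case: eqP => [-> T1|_ [S S1 TE]].
  by exists T => // x; rewrite scale1r.
exists S => // x; rewrite TE scalerBl scale1r scalerBr opprD opprB.
by rewrite !addrA [x + _]addrC addrK.
Qed.

(** With [S] the nonexpansive part of [T], expand [|S w - z| <= |w - z|] where
    [S w = w - alpha^-1 *: residual T w]. *)
Lemma residual_cocoercive (w z : H) : fix_points T z ->
  `|residual T w| ^+ 2 <= 2 * alpha * ip (residual T w) (w - z).
Proof.
move=> /= Tz; have [S S1 RE] := averaged_residual.
have Sz : S z = z.
  have /eqP := RE z; rewrite /residual Tz subrr eq_sym scaler_eq0.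
  by rewrite gt_eqF //= subr_eq0 => /eqP <-.
have SwE : S w - S z = (w - z) - alpha^-1 *: residual T w.
  rewrite Sz RE scalerA mulVf ?gt_eqF // scale1r opprB.
  by rewrite [RHS]addrC addrA subrK.
have := S1 w z; rewrite -(ler_pXn2r (n := 2)) ?nnegrE // SwE sqr_normB_scale.
set v := `|residual T w|; set i := ip _ _; set A := `|w - z| ^+ 2 => le.
have : alpha^-1 ^+ 2 * v ^+ 2 <= 2 * alpha^-1 * i by lra.
rewrite -(ler_pM2l (x := alpha ^+ 2)) ?exprn_gt0 //.
have -> : alpha ^+ 2 * (alpha^-1 ^+ 2 * v ^+ 2) = v ^+ 2.
  by rewrite mulrA -exprMn mulfV ?gt_eqF // expr1n mul1r.
suff -> : alpha ^+ 2 * (2 * alpha^-1 * i) = 2 * alpha * i by [].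
by field; rewrite gt_eqF.
Qed.

(** Cocoercivity at [w] says that the half-space
    [{y | 2 * alpha * ip (residual T w) (x - y) >= rho}] contains the fixed
    points, and the safeguard update is a relaxed projection of [x] onto it. *)
Lemma safeguard_fejer (p : sm_parameters R) (x w z : H) :
  admissible alpha p -> fix_points T z -> residual T w != 0 ->
  sm_sigma p * `|residual T w| * `|residual T x| <= rho ip alpha T x w ->
  `|x - (sm_lambda p * (rho ip alpha T x w / `|residual T w| ^+ 2))
          *: residual T w - z| ^+ 2
    <= `|x - z| ^+ 2
       - sm_lambda p * (1 / alpha - sm_lambda p) * sm_sigma p ^+ 2
         * `|residual T x| ^+ 2.
Proof.
case=> _ [_ /andP[sigma0 _] /andP[lambda0 lambda1]] Tz Rw0 test.
have coco := residual_cocoercive w Tz.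
have v0 : 0 < `|residual T w| by rewrite normr_gt0.
rewrite addrAC sqr_normB_scale.
have ipE : ip (residual T w) (w - z)
           = ip (residual T w) (x - z) + ip (residual T w) (w - x).
  by rewrite -linearDr /= [x - z + _]addrC addrA subrK.
move: test coco; rewrite /rho ipE.
set v := `|residual T w| in v0 *; set a := `|residual T x|.
set I := ip _ (x - z); set J := ip _ (w - x); set A := `|x - z| ^+ 2.
set l := sm_lambda p in lambda0 lambda1 *; set s := sm_sigma p in sigma0 *.
set t := (_ / v ^+ 2) => test coco.
have tE : v ^+ 2 - 2 * alpha * J = t * v ^+ 2.
  by rewrite /t divfK // gt_eqF // exprn_gt0.
have a0 : 0 <= a by exact: normr_ge0.
have sa : s * a <= t * v.
  rewrite -(ler_pM2r v0) mulrAC.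
  apply: (le_trans test).
  by rewrite tE expr2 mulrA.
have t0 : 0 <= t.
  by rewrite -(pmulr_lge0 _ v0); apply: (le_trans _ sa); rewrite mulr_ge0 // ltW.
have sa2 : s ^+ 2 * a ^+ 2 <= t ^+ 2 * v ^+ 2.
  by rewrite -!exprMn ler_pXn2r ?nnegrE // mulr_ge0 // ltW.
have tI : t * v ^+ 2 / alpha <= 2 * I by rewrite ler_pdivrMr //; lra.
have := ler_wpM2l (mulr_ge0 (ltW lambda0) t0) tI.
have l2 : 0 < l * (1 / alpha - l) by rewrite mulr_gt0 // subr_gt0.
have := ler_wpM2l (ltW l2) sa2.
rewrite div1r; set ia := alpha^-1; nra.
Qed.

End Geometry.

(** * A single iteration *)

Section Step.
Set Implicit Arguments. Unset Strict Implicit.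
Variables (R : realType) (H : completeNormedModType R).
Variables (ip : {dot H for idfun}) (alpha : R) (p : sm_parameters R).
Variables (T : H -> H) (k : nat) (s : state H) (d : H).
Variables (v : update) (i : nat) (s' : state H).
Hypothesis st : step ip alpha p T k s d v i s'.
Local Notation res y := (`|residual T y|).

Lemma step_blind_accept : res (iterate s) <= sm_c0 p * eta s -> v = Blind.
Proof. by case: st. Qed.

Lemma step_blind : v = Blind ->
  [/\ i = 0%N, res (iterate s) <= sm_c0 p * eta s,
      iterate s' = iterate s + d & eta s' = res (iterate s)].
Proof. by case: st. Qed.

Lemma step_eta : v <> Blind -> eta s' = eta s.
Proof. by case: st. Qed.

Lemma candidate0 : candidate p (iterate s) d 0 = iterate s + d.
Proof. by rewrite /candidate expr0 scale1r. Qed.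

(** The first candidate of the line search is already accepted, so neither a
    later candidate nor a safeguard update at the first one is reached. *)
Lemma step_educated_accept :
  ~ res (iterate s) <= sm_c0 p * eta s ->
  educated_test p T s (iterate s + d) ->
  [/\ v = Educated, i = 0%N & iterate s' = iterate s + d].
Proof.
have accept0 n : (forall m, (m < n)%N ->
    rejected ip alpha p T s (candidate p (iterate s) d m)) ->
    educated_test p T s (iterate s + d) -> n = 0%N.
  by case: n => // n /(_ 0%N isT)[+ _]; rewrite candidate0.
case: st => [le /(_ le) //|n w _ rej _ _|n w _ rej Nedu _ _] edu.
  by rewrite /w (accept0 _ rej edu) candidate0.
by move: Nedu; rewrite /w (accept0 _ rej edu) candidate0 => /(_ edu).
Qed.

Lemma step_educated : v = Educated ->
  [/\ res (iterate s) <= r_safe s,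
      res (iterate s') <= sm_c1 p * res (iterate s) &
      r_safe s' = res (iterate s') + sm_q p ^+ k].
Proof. by case: st => // n w _ _ [? ?]. Qed.

Lemma step_r_safe : v <> Educated -> r_safe s' = r_safe s.
Proof. by case: st. Qed.

Lemma step_safeguard (w := candidate p (iterate s) d i) : v = Safeguard ->
  safeguard_test ip alpha p T s w /\
  iterate s' = iterate s
    - (sm_lambda p * (rho ip alpha T (iterate s) w / res w ^+ 2))
        *: residual T w.
Proof. by rewrite {}/w; case: st. Qed.

End Step.

(** * Executions of the scheme *)

Section Run.
Set Implicit Arguments. Unset Strict Implicit.
Variables (R : realType) (H : completeNormedModType R).
Variables (ip : {dot H for idfun}) (ip_norm : induces_norm ip).
Variables (T : H -> H) (alpha : R).
Hypotheses (alpha_range : 0 < alpha <= 1) (T_averaged : averaged alpha T).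
Hypothesis T_fix : fix_points T !=set0.
Variables (p : sm_parameters R) (p_admissible : admissible alpha p).
Variables (x0 : H) (d : nat -> H).
Variables (s : nat -> state H) (u : nat -> update) (j : nat -> nat).
Hypotheses (run : supermann ip alpha p T x0 d s u j).
Hypothesis nonstop : no_finite_termination p T d s j.
Local Notation x k := (iterate (s k)).
Local Notation res y := (`|residual T y|).

Let st k : step ip alpha p T k (s k) (d k) (u k) (j k) (s k.+1) :=
  supermann_step run k.

Lemma res_gt0 k : 0 < res (x k).
Proof. by rewrite normr_gt0; case: nonstop. Qed.

Lemma eta_gt0 k : 0 < eta (s k).
Proof.
elim: k => [|k IHk].
  by have := res_gt0 0; rewrite (supermann_init run).
have := step_blind (st k); have := step_eta (st k).
by case: (u k) => [_ [//|_ _ _ ->]|-> //|-> //]; exact: res_gt0.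
Qed.

Lemma r_safe_gt0 k : 0 < r_safe (s k).
Proof.
case: p_admissible => -[_ _ /andP[q0 _]] _.
elim: k => [|k IHk].
  by have := res_gt0 0; rewrite (supermann_init run).
have := step_educated (st k); have := step_r_safe (st k).
case: (u k) => [-> //|_ [//|_ _ ->]|-> //].
by rewrite ltr_pwDl ?res_gt0 // exprn_ge0.
Qed.

(** The squared distance to a fixed point is nonincreasing with decrements
    proportional to the squared residual. *)
Lemma safeguard_tail_small N (e : R) :
  (forall k, (N <= k)%N -> u k = Safeguard) -> 0 < e ->
  exists2 k, (N <= k)%N & res (x k) <= e.
Proof.
move=> uN e0; have [z Tz] := T_fix; have /andP[alpha0 _] := alpha_range.
have [_ [_ /andP[sigma0 _] /andP[lambda0 lambda1]]] := p_admissible.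
pose c := sm_lambda p * (1 / alpha - sm_lambda p) * sm_sigma p ^+ 2.
have c0 : 0 < c by rewrite !mulr_gt0 ?exprn_gt0 // subr_gt0.
have fejer k : (N <= k)%N ->
    `|x k.+1 - z| ^+ 2 <= `|x k - z| ^+ 2 - c * res (x k) ^+ 2.
  move=> /uN /(step_safeguard (st k))[test ->].
  apply: (safeguard_fejer ip_norm) => //.
  by case: nonstop => _; apply.
have ce0 : 0 < c * e ^+ 2 by rewrite mulr_gt0 // exprn_gt0.
have [||M _ decM] :=
    decrement_lt (a := fun k => `|x k - z| ^+ 2) (N := N) ce0.
- by move=> k _; exact: exprn_ge0.
- move=> k /fejer le; apply: le_trans le _.
  by rewrite gerBl mulr_ge0 ?exprn_ge0 // ltW.
exists (maxn N M); first exact: leq_maxl.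
have := decM _ (leq_maxr N M); have := fejer _ (leq_maxl N M).
rewrite /= => le lt.
have : c * res (x (maxn N M)) ^+ 2 < c * e ^+ 2 by lra.
by rewrite ltr_pM2l // ltr_pXn2r ?nnegrE ?(ltW e0) //; exact: ltW.
Qed.

(** An educated update replaces [r_safe] by at most [c1 * res (x k) + q ^ k],
    where [res (x k) <= r_safe]. If the residual stayed above [e], every late
    educated update would lower [r_safe] by at least [(1 - c1) * e / 2], namely
    as soon as [q ^ k] is below that amount. *)
Lemma educated_infinitely_often_small N (e : R) :
  (forall M, exists2 k, (M <= k)%N & u k = Educated) -> 0 < e ->
  exists2 k, (N <= k)%N & res (x k) <= e.
Proof.
move=> edu e0; apply: contrapT => big.
have {}big k : (N <= k)%N -> e < res (x k).
  by move=> Nk; rewrite ltNge; apply/negP => le; apply: big; exists k.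
have [[_ /andP[c10 c11] /andP[q0 q1]] _] := p_admissible.
pose delta := (1 - sm_c1 p) * e / 2.
have delta0 : 0 < delta by rewrite divr_gt0 // mulr_gt0 // subr_gt0.
have [M _ qM] : \forall k \near \oo, sm_q p ^+ k < delta.
  by apply: cvgr_lt delta0; apply: cvg_expr; rewrite ger0_norm.
have drop k : (maxn N M <= k)%N -> u k = Educated ->
    r_safe (s k.+1) <= r_safe (s k) - delta.
  rewrite geq_max => /andP[Nk Mk] /(step_educated (st k))[le1 le2 ->].
  have /= := qM _ Mk; have := big _ Nk.
  move: le1 le2 delta0; rewrite /delta.
  set a := res (x k); set b := res (x k.+1).
  set c := sm_c1 p in c10 c11 *; nra.
have [||M' _ decM] :=
    decrement_lt (a := fun k => r_safe (s k)) (N := maxn N M) delta0.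
- by move=> k _; exact/ltW/r_safe_gt0.
- move=> k kNM; have := drop _ kNM; have := step_r_safe (st k).
  by case: (u k) => [-> //|_ /(_ erefl)|-> //]; lra.
have [k] := edu (maxn (maxn N M) M').
rewrite geq_max => /andP[kNM kM'] /(drop _ kNM).
have /= := decM _ kM'; lra.
Qed.

Lemma nonblind_tail_small N (e : R) :
  (forall k, (N <= k)%N -> u k <> Blind) -> 0 < e ->
  exists2 k, (N <= k)%N & res (x k) <= e.
Proof.
move=> nb e0.
have [edu|] := pselect (forall M, exists2 k, (M <= k)%N & u k = Educated).
  exact: educated_infinitely_often_small.
move=> /existsNP[M noedu].
have [|k kNM small] := safeguard_tail_small (N := maxn N M) _ e0.
  move=> k; rewrite geq_max => /andP[/nb Nb Mk].
  by case E: (u k) Nb => // _; case: noedu; exists k.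
by exists k => //; apply: leq_trans kNM; exact: leq_maxl.
Qed.

Hypothesis d_superlinear : superlinear_directions T (fun k => x k) d.

Lemma superlinear_contracts (c : R) : 0 < c ->
  exists N, forall k, (N <= k)%N -> res (x k + d k) <= c * res (x k).
Proof. exact: ratio_cvg0_le res_gt0 d_superlinear. Qed.

(** A late blind update is followed by blind updates only, because it sets
    [eta] to the current residual, which the next full step contracts by [c0].
    A late blind update exists: otherwise [eta] would be eventually constant
    and positive, and the residual would fall below [c0 * eta]. *)
Lemma eventually_blind : 0 < sm_c0 p ->
  exists N, forall k, (N <= k)%N -> u k = Blind.
Proof.
move=> c0; have [N contr] := superlinear_contracts c0.
have [k0 Nk0 uk0] : exists2 k, (N <= k)%N & u k = Blind.
  apply: contrapT => no.
  have nb k : (N <= k)%N -> u k <> Blind by move=> Nk uk; apply: no; exists k.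
  have etaN m : eta (s (N + m)%N) = eta (s N).
    elim: m => [|m <-]; first by rewrite addn0.
    by rewrite addnS (step_eta (st _)) //; apply: nb; exact: leq_addr.
  have [k Nk] := nonblind_tail_small nb (mulr_gt0 c0 (eta_gt0 N)).
  rewrite -(etaN (k - N)%N) subnKC // => /(step_blind_accept (st k)).
  exact: nb.
exists k0 => k k0k; rewrite -(subnKC k0k).
elim: (k - k0)%N => [|m IHm]; first by rewrite addn0.
rewrite addnS; apply: (step_blind_accept (st _)).
have [_ _ -> ->] := step_blind (st _) IHm.
by apply: contr; rewrite (leq_trans Nk0) // leq_addr.
Qed.

(** Once the full step contracts the residual by [c1], the educated test at
    [tau = 1] amounts to [res (x k) <= r_safe]. An educated update makes it
    true at the next iterate, since [q ^ k >= 0]; and it is true at least once,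
    for otherwise [r_safe] would be eventually constant and positive, and the
    residual would fall below it. *)
Lemma eventually_educated : sm_c0 p = 0 -> 0 < sm_c1 p ->
  exists N, forall k, (N <= k)%N ->
    [/\ u k = Educated, j k = 0%N & x k.+1 = x k + d k].
Proof.
move=> c00 c1; have [N contr] := superlinear_contracts c1.
have [[_ _ /andP[q0 _]] _] := p_admissible.
have nb k : ~ res (x k) <= sm_c0 p * eta (s k).
  by rewrite c00 mul0r leNgt res_gt0.
have accept k : (N <= k)%N -> res (x k) <= r_safe (s k) ->
    [/\ u k = Educated, j k = 0%N & x k.+1 = x k + d k].
  move=> Nk le; apply: (step_educated_accept (st k)) => //.
  by split=> //; exact: contr.
have [k0 Nk0 rk0] : exists2 k, (N <= k)%N & res (x k) <= r_safe (s k).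
  apply: contrapT => no.
  have ne k : (N <= k)%N -> u k <> Educated.
    move=> Nk uk; apply: no; exists k => //.
    by have [] := step_educated (st k) uk.
  have safeN m : r_safe (s (N + m)%N) = r_safe (s N).
    elim: m => [|m <-]; first by rewrite addn0.
    by rewrite addnS (step_r_safe (st _)) //; apply: ne; exact: leq_addr.
  have [|k Nk small] := nonblind_tail_small (N := N) _ (r_safe_gt0 N).
    by move=> k _ /(step_blind (st k))[_ /nb].
  by apply: no; exists k => //; rewrite -(subnKC Nk) safeN subnKC.
exists k0 => k k0k; apply: (accept k); first exact: leq_trans Nk0 k0k.
rewrite -(subnKC k0k).
elim: (k - k0)%N => [|m IHm]; first by rewrite addn0.
have [|edu _ _] := accept _ _ IHm; first by rewrite (leq_trans Nk0) // leq_addr.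
have [_ _ safe] := step_educated (st _) edu.
by rewrite addnS safe lerDl exprn_ge0.
Qed.

(** If [c0 > 0] the tail is blind, and blind updates bypass the line search;
    otherwise it consists of educated updates at the first candidate. *)
Lemma eventually_full_step : 0 < sm_c0 p \/ 0 < sm_c1 p ->
  exists N, forall k, (N <= k)%N ->
    [/\ j k = 0%N, u k <> Safeguard & x k.+1 = x k + d k].
Proof.
move=> c_pos; have [[/andP[c0 _] _ _] _] := p_admissible.
have [c00|c0_neq0] := eqVneq (sm_c0 p) 0.
  case: c_pos => [|c1]; first by rewrite c00 ltxx.
  have [N eduN] := eventually_educated c00 c1.
  by exists N => k /eduN[-> -> ->].
have [|N blindN] := eventually_blind; first by rewrite lt0r c0_neq0.
exists N => k /blindN uk.
by have [-> _ -> _] := step_blind (st k) uk; rewrite uk.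
Qed.

End Run.

Theorem mainTheorem6 (R : realType) (H : completeNormedModType R)
    (ip : {dot H for idfun}) (ip_norm : induces_norm ip)
    (H_separable : separable H)
    (T : H -> H) (alpha : R) (alpha_range : 0 < alpha <= 1)
    (T_averaged : averaged alpha T) (T_fix : fix_points T !=set0)
    (p : sm_parameters R) (p_admissible : admissible alpha p)
    (x0 : H) (d : nat -> H)
    (s : nat -> state H) (u : nat -> update) (j : nat -> nat)
    (x := fun k : nat => iterate (s k)) (tau := stepsize p j)
    (K0 := indices_of u Blind) (K2 := indices_of u Safeguard)
    (run : supermann ip alpha p T x0 d s u j)
    (nonstop : no_finite_termination p T d s j)
    (c_pos : 0 < sm_c0 p \/ 0 < sm_c1 p)
    (d_superlinear : superlinear_directions T x d) :
  [/\ (\forall k \near \oo,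
         [/\ tau k = 1, ~ K2 k & x k.+1 = x k + d k]),
      q_superlinear_to0 (fun k => residual T (x k)),
      (forall D : R, 0 <= D ->
         (forall k : nat, `|d k| <= D * `|residual T (x k)|) ->
         exists xstar : H, r_superlinear_to x xstar) &
      (0 < sm_c0 p -> finite_set (~` K0))].
Proof.
have [N fullN] := eventually_full_step ip_norm alpha_range T_averaged T_fix
  p_admissible run nonstop d_superlinear c_pos.
have res0 := res_gt0 nonstop.
have superlinear : q_superlinear_to0 (fun k => residual T (x k)).
  apply: cvg_trans d_superlinear; apply: near_eq_cvg; exists N => // k /= Nk.
  by rewrite /x; have [_ _ ->] := fullN _ Nk.
split=> //.
- exists N => // k /= Nk; have [jk Nuk xk] := fullN _ Nk.
  by split=> //; rewrite /tau /stepsize jk expr0.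
- move=> D D0 dD.
  apply: (r_superlinear_of_increments (r := fun k => `|residual T (x k)|)
            (D := D) (N0 := N)) => // k Nk.
  by rewrite /x; have [_ _ ->] := fullN _ Nk; rewrite addrC addKr; exact: dD.
- move=> c0; have [M blindM] := eventually_blind ip_norm alpha_range T_averaged
    T_fix p_admissible run nonstop d_superlinear c0.
  apply: sub_finite_set (finite_II M) => k Nuk /=.
  by rewrite ltnNge; apply/negP => /blindM.
Qed.
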